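(* For every claw-free bridgeless cubic graph $G$, $\nu_3(G) \geq \frac{43}{45}\cdot |E(G)|$.
   Context: Graphs are finite, without loops, possibly with multiple edges; a graph is cubic if every vertex has degree $3$, bridgeless if it has no edge whose removal increases the number of connected components, and claw-free if it has no induced subgraph isomorphic to $K_{1,3}$. $\nu_3(G)$ is the maximum number of edges of a $3$-edge-colorable subgraph of $G$. *)

(* Defs.v *)
(* A finite loopless multigraph is given by a finite vertex
   type V, a finite edge type E and two endpoint maps s t : E -> V
   (an edge e joins s e and t e; parallel edges allowed). *)
From mathcomp Require Import all_boot all_algebra.
Set Implicit Arguments.
Unset Strict Implicit.
Unset Printing Implicit Defensive.

Section Graphs.
Variables (V E : finType) (s t : E -> V).

Definition loopless := forall e : E, s e != t e.

Definition incident (v : V) (e : E) : bool := (s e == v) || (t e == v).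

Definition joins (e : E) (u v : V) : bool :=
  ((s e == u) && (t e == v)) || ((s e == v) && (t e == u)).

Definition degree (v : V) : nat := #|[set e : E | incident v e]|.

Definition cubic := forall v : V, degree v = 3.

Definition gadj (F : {set E}) : rel V :=
  fun u v => [exists e in F, joins e u v].

Definition ncomp (F : {set E}) : nat := n_comp (gadj F) (@predT V).

Definition is_bridge (e : E) : bool :=
  ncomp [set: E] < ncomp ([set: E] :\ e).

Definition bridgeless := forall e : E, ~~ is_bridge e.

Definition mult (u v : V) : nat := #|[set e : E | joins e u v]|.

Definition induced_claw (c a1 a2 a3 : V) : Prop :=
  uniq [:: c; a1; a2; a3] /\
  mult c a1 = 1 /\ mult c a2 = 1 /\ mult c a3 = 1 /\
  mult a1 a2 = 0 /\ mult a1 a3 = 0 /\ mult a2 a3 = 0.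

Definition claw_free := forall c a1 a2 a3 : V, ~ induced_claw c a1 a2 a3.

Definition three_edge_colorable (F : {set E}) : bool :=
  [exists col : {ffun E -> 'I_3}, [forall e : E, forall f : E,
    [&& e \in F, f \in F, e != f & [exists v : V, incident v e && incident v f]]
      ==> (col e != col f)]].

Definition nu3 : nat :=
  \max_(F : {set E} | three_edge_colorable F) #|F|.

End Graphs.

(* Main.v *)
(* Let [c] be a partial proper 3-edge-colouring with the fewest uncoloured edges.
   An uncoloured edge [e = uv], with colour [a] missing at [u] and [b] at [v], can
   be shifted along its chain, the component of [e] among the edges coloured [a]
   or [b] together with [e]: colour [e] with [b] and uncolour the [b]-edge at [u].
   Shifting keeps [c] optimal, which forces the uncoloured edges to form a matching
   and their chains to be vertex-disjoint cycles of odd length, of length at least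
   5 when every vertex is the centre of a claw.

   A vertex that is not the centre of a claw lies on a triangle or a digon, hence
   bridgelessness yields three vertices spanning exactly three edges. Contracting
   them keeps the graph cubic and without 1-edge cuts, and a partial colouring of
   the contracted graph lifts without new uncoloured edges. Giving the contracted
   vertex the total weight of the three, we end with a graph in which every vertex
   has weight at least 3 and every chain at least 5 vertices, so there are at
   most |V|/15 uncoloured edges, where 3|V| = 2|E|. *)
Require Import Defs.
From mathcomp Require Import all_boot all_algebra.
From mathcomp Require Import zify.
Set Implicit Arguments.
Unset Strict Implicit.
Unset Printing Implicit Defensive.

(** * Partial 3-edge-colourings and incidences in a cubic multigraph *)

Local Notation color := (option bool).

Section Kempe.
Variables (V E : finType) (s t : E -> V).
Local Notation inc := (incident s t).
Local Notation joins := (joins s t).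
Local Notation gadj := (gadj s t).

Definition cut (S : {set V}) : {set E} := [set e | (s e \in S) != (t e \in S)].

(** The value [None] means uncoloured, whereas [Some None] is one of the three colours, the elements
    of [option bool]. *)
Definition proper (c : E -> option color) :=
  forall v e f, inc v e -> inc v f -> e != f -> c e = c f -> c e = None.

Definition uncolored (c : E -> option color) := #|[set e | c e == None]|.

Definition optimal c :=
  proper c /\ forall c', proper c' -> uncolored c <= uncolored c'.

Definition missing (c : E -> option color) a v := forall e, inc v e -> c e <> Some a.

Definition state c e u v a b :=
  [/\ c e = None, joins e u v, missing c a u & missing c b v].

Definition chain (c : E -> option color) e a b :=
  [set g | [|| g == e, c g == Some a | c g == Some b]].

Definition move c (e f : E) (b : color) : E -> option color :=
  fun g => if g == e then Some b else if g == f then None else c g.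

(** Two edges at [v] form a digon or are two sides of a triangle. This positive form of not being
    the centre of an induced claw is the one that contraction preserves. *)
Definition not_claw_center v := exists e f p q,
  [/\ e != f, joins e v p, joins f v q & p = q \/ exists g, joins g p q].

Lemma joinsC e u v : joins e u v = joins e v u.
Proof. by rewrite /Defs.joins orbC. Qed.

Lemma joins_incl e u v : joins e u v -> inc u e.
Proof. by rewrite /incident => /orP[]/andP[/eqP-> /eqP->]; rewrite eqxx ?orbT. Qed.

Lemma joins_incr e u v : joins e u v -> inc v e.
Proof. by rewrite joinsC; apply: joins_incl. Qed.

Lemma incP e u : inc u e -> exists v, joins e u v.
Proof.
rewrite /incident => /orP[/eqP<-|/eqP<-]; first by exists (t e); rewrite /Defs.joins !eqxx.
by exists (s e); rewrite /Defs.joins !eqxx orbT.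
Qed.

Lemma inc_joins e u v w : joins e u v -> inc w e -> w = u \/ w = v.
Proof.
by rewrite /incident => /orP[]/andP[/eqP-> /eqP->] /orP[]/eqP->; [left|right|right|left].
Qed.

Lemma joins_st e u v : joins e u v -> (s e = u /\ t e = v) \/ (s e = v /\ t e = u).
Proof. by move=> /orP[]/andP[/eqP-> /eqP->]; [left|right]. Qed.

Lemma gadj_sym F : symmetric (gadj F).
Proof.
by move=> u v; apply/existsP/existsP=> -[g /andP[gF j]]; exists g; rewrite gF joinsC.
Qed.

Lemma gadjP (F : {set E}) u v : reflect (exists2 g, g \in F & joins g u v) (gadj F u v).
Proof.
apply: (iffP existsP) => [[g /andP[]]|[g]]; first by exists g.
by exists g; apply/andP.
Qed.

Hypothesis loopless_st : loopless s t.

Lemma joins_neq e u v : joins e u v -> u != v.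
Proof.
by have := loopless_st e; move=> /[swap]/joins_st[[-> ->]|[-> ->]]//; rewrite eq_sym.
Qed.

Lemma joins_fun e u v w : joins e u v -> joins e u w -> v = w.
Proof.
move=> j1 j2; have n1 := joins_neq j1.
by case: (inc_joins j2 (joins_incr j1)) => // vu; rewrite vu eqxx in n1.
Qed.

(** Double counting of incidences: without loops, an edge contributes one for each of its ends in
    [X]. *)
Lemma handshake (F : {set E}) (X : {set V}) :
  \sum_(v in X) #|[set e in F | inc v e]| =
    2 * #|[set e in F | (s e \in X) && (t e \in X)]| + #|F :&: cut X|.
Proof.
have cardS (P : pred E) : #|[set e in F | P e]| = \sum_(e in F) P e.
  by rewrite -sum1dep_card big_mkcondr; apply: eq_bigr => e _; case: (P e).
have FX : F :&: cut X = [set e in F | e \in cut X] by apply/setP=> e; rewrite !inE.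
under eq_bigr => v _ do rewrite cardS.
rewrite exchange_big FX !cardS big_distrr -big_split /=.
apply: eq_bigr => e _; rewrite inE.
have dis v : inc v e = (s e == v) + (t e == v) :> nat.
  rewrite /incident; have := loopless_st e.
  by case: (eqVneq (s e) v) => [->|_] /=; [rewrite eq_sym => /negPf-> |].
under eq_bigr => v _ do rewrite dis.
have sumX x : \sum_(i in X) (x == i : nat) = (x \in X).
  have [xX|xX] := boolP (x \in X).
    by rewrite (bigD1 x) //= eqxx big1 // => i /andP[_]; rewrite eq_sym => /negPf->.
  by rewrite big1 // => i iX; case: eqVneq iX xX => // <- ->.
rewrite big_split /= !sumX.
by case: (s e \in X); case: (t e \in X).
Qed.

Hypothesis cubic_st : cubic s t.

Lemma none_uncolor c e : c e <> None ->
  uncolored (fun g => if g == e then None else c g) = (uncolored c).+1.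
Proof.
move=> ce; rewrite /uncolored (_ : [set _ | _] = e |: [set g | c g == None]).
  by rewrite cardsU1 inE; case: (c e) ce.
by apply/setP=> g; rewrite !inE; case: (g == e).
Qed.

Lemma none_color c e a : c e = None ->
  (uncolored (fun g => if g == e then Some a else c g)).+1 = uncolored c.
Proof.
move=> ce; rewrite /uncolored [in RHS](cardsD1 e) inE ce eqxx add1n; congr _.+1.
by apply: eq_card=> g; rewrite !inE; case: (g == e).
Qed.

Lemma proper_color c e u v a : proper c -> joins e u v ->
  (forall f, f != e -> inc u f -> c f <> Some a) ->
  (forall f, f != e -> inc v f -> c f <> Some a) ->
  proper (fun g => if g == e then Some a else c g).
Proof.
move=> pc j mu mv w g h wg wh gh.
have [ge|ge] := eqVneq g e; have [he|he] := eqVneq h e; first by rewrite ge he eqxx in gh.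
- subst g => Ea; case: (inc_joins j wg) => wE; subst w.
  + by case: (mu h he wh).
  + by case: (mv h he wh).
- subst h => Ea; case: (inc_joins j wh) => wE; subst w.
  + by case: (mu g ge wg).
  + by case: (mv g ge wg).
- exact: pc wg wh gh.
Qed.

Lemma proper_uncolor c e : proper c -> proper (fun g => if g == e then None else c g).
Proof.
move=> pc w g h wg wh gh.
by case: (g == e) => //; case: (h == e) => //; apply: pc wg wh gh.
Qed.

Lemma missing_dec c a v : missing c a v \/ (exists2 e, inc v e & c e = Some a).
Proof.
case: (boolP [exists e, inc v e && (c e == Some a)]) => [/existsP[e /andP[i /eqP]]|H].
  by right; exists e.
left=> e ve ce; case/negP: H; apply/existsP; exists e; by rewrite ve ce eqxx.
Qed.

Lemma no_common c e u v a : optimal c -> c e = None -> joins e u v ->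
  missing c a u -> missing c a v -> False.
Proof.
move=> [pc oc] ce j mu mv.
have := oc _ (@proper_color c e u v a pc j (fun f _ => mu f) (fun f _ => mv f)).
by rewrite -(none_color a ce) ltnn.
Qed.

(** * Shifting an uncoloured edge along its chain *)

Lemma state_flip c e u v a b : state c e u v a b -> state c e v u b a.
Proof. by case=> ce j mu mv; split=> //; rewrite joinsC. Qed.

Lemma chainC c e a b : chain c e a b = chain c e b a.
Proof. by apply/setP=> g; rewrite !inE [_ || (_ == Some b)]orbC. Qed.

Lemma state_neq c e u v a b : optimal c -> state c e u v a b -> a <> b.
Proof. by move=> oc [ce j mu mv] ab; subst b; apply: no_common oc ce j mu mv. Qed.

(** One step of the shift: by [no_common] some edge [f = ux] has colour [b]. After the step [b] is
    missing at [x] and [a] still at [u], so the colours swap roles while the chain stays the same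
    edge set; the step can be iterated. *)
Lemma moveP c e u v a b : optimal c -> state c e u v a b ->
  exists f x, [/\ f != e, c f = Some b, joins f u x, optimal (move c e f b)
    & state (move c e f b) f x u b a] /\ chain (move c e f b) f b a = chain c e a b.
Proof.
move=> oc st; have ab := state_neq oc st; have [ce j mu mv] := st.
case: (missing_dec c b u) => [mb|[f uf cf]]; first by case: (no_common oc ce j mb mv).
have [x jf] := incP uf.
have fe : f != e by apply/eqP=> fe; move: cf; rewrite fe ce.
have [pc oo] := oc.
exists f, x; split; first split => //.
- split.
    have pf := @proper_uncolor c f pc.
    apply: (proper_color pf j) => g ge ig.
      case: eqVneq => // gf cg; have := pc _ _ _ ig uf gf; rewrite cg cf; move/(_ erefl) => //.
    by case: eqVneq => // gf; apply: mv.
  move=> c' pc'; apply: leq_trans (oo c' pc').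
  have cfN : c f <> None by rewrite cf.
  (* The move uncolours [f] and then colours [e], so the number of uncoloured edges is unchanged. *)
  have := none_uncolor cfN.
  have cne : (if e == f then None else c e) = None by rewrite ce; case: ifP.
  by rewrite -(none_color b cne) => -[<-].
- split; rewrite /move ?(negPf fe) ?eqxx //; first by rewrite joinsC.
    move=> g ig; case: eqVneq => [gE|ge].
      subst g; case: (inc_joins j ig) => xE.
        by have := joins_neq jf; rewrite xE eqxx.
      by subst x; case: (mv f (joins_incr jf)).
    case: eqVneq => // gf cg.
    by have := pc _ _ _ ig (joins_incr jf) gf; rewrite cg cf; move/(_ erefl).
  move=> g ig; case: eqVneq => [_ [ba]|ge]; first by case: ab.
  by case: eqVneq => // gf; apply: mu.
- apply/setP=> g; rewrite !inE /move.
  case: (eqVneq g e) => [->|ge]; first by rewrite eqxx /= orbT.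
  case: (eqVneq g f) => [->|gf] /=; first by rewrite cf eqxx !orbT.
  by rewrite orbC.
Qed.

(** The only chain edges at [u] are [e] and the [b]-edge [f]. Following [e] reverses the state and
    following [f] is a shift, so the uncoloured edge can be brought to any vertex of its
    component. *)
Lemma rotate p c e u v a b : optimal c -> state c e u v a b ->
  path (gadj (chain c e a b)) u p ->
  exists c' g v' a' b', [/\ optimal c', state c' g (last u p) v' a' b',
    chain c' g a' b' = chain c e a b & forall h, h \notin chain c e a b -> c' h = c h].
Proof.
elim: p c e u v a b => [|y p IH] c e u v a b oc st /=.
  by move=> _; exists c, e, v, a, b.
case/andP=> /gadjP[g gM jg] pth.
have [ce j mu mv] := st.
have [gE|ge] := eqVneq g e.
  subst g; rewrite -(joins_fun j jg) in pth *.
  rewrite chainC in pth *; exact: (IH _ _ _ _ _ _ oc (state_flip st) pth).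
have [f [x [[fe cf jf oc1 st1] chE]]] := moveP oc st.
have gf : g = f.
  move: gM; rewrite inE (negPf ge) /= => /orP[]/eqP cg.
    by case: (mu g (joins_incl jg)).
  apply/eqP; case: eqVneq => // gf.
  by have := oc.1 _ _ _ (joins_incl jg) (joins_incl jf) gf; rewrite cg cf; move/(_ erefl).
subst g; rewrite -(joins_fun jf jg) in pth *.
rewrite -chE in pth.
have [c' [g [v' [a' [b' [o' s' ch' same]]]]]] := IH _ _ _ _ _ _ oc1 st1 pth.
exists c', g, v', a', b'; split=> //; first by rewrite ch'.
move=> h hM; rewrite same ?chE // /move.
by move: hM; rewrite !inE; case: (eqVneq h e) => //= he; case: (eqVneq h f) => // ->; rewrite cf eqxx orbT.
Qed.

(** Once the uncoloured edge is brought to [w], it and the edge that the next shift would uncolour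
    are two chain edges there. *)
Lemma chain_deg2 c e u v a b w : optimal c -> state c e u v a b ->
  connect (gadj (chain c e a b)) u w ->
  exists g h, [/\ g != h, g \in chain c e a b, h \in chain c e a b, inc w g & inc w h].
Proof.
move=> oc st /connectP[p pth ->].
have [c' [g [v' [a' [b' [o' s' <- _]]]]]] := rotate oc st pth.
have [f [x [[fe cf jf _ _] _]]] := moveP o' s'.
exists g, f; split; rewrite ?(joins_incl jf) // 1?eq_sym ?inE ?eqxx ?cf ?eqxx ?orbT //.
by case: s' => _ /joins_incl.
Qed.

(** * Missing colours, and why uncoloured edges form a matching *)

(** The degree and the number of colours are both three, and the coloured edges at [v] use distinct
    colours. *)
Lemma card_missing c v : proper c ->
  #|[set a : color | [forall e, inc v e ==> (c e != Some a)]]| =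
  #|[set e | inc v e & c e == None]|.
Proof.
move=> pc; pose D := [set e | inc v e & c e != None].
have cardD : #|[set e | inc v e & c e == None]| + #|D| = 3.
  rewrite -(cubic_st v) /degree -(cardsID [set e | c e == None] [set e | incident s t v e]).
  by congr (_ + _); apply: eq_card => e; rewrite !inE // andbC.
pose A := [set a : color | [forall e, inc v e ==> (c e != Some a)]].
have AD : ~: A = [set odflt None (c e) | e in D].
  apply/setP=> a; rewrite !inE negb_forall.
  apply/existsP/imsetP=> [[e]|[e]].
    by rewrite negb_imply negbK => /andP[ve /eqP ce]; exists e; rewrite ?inE ?ve ce.
  rewrite inE => /andP[ve ce] ->; exists e; rewrite ve /=.
  by case: (c e) ce => //= b; rewrite eqxx.
have cardA : #|A| + #|D| = 3.
  have <- : #|~: A| = #|D|.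
    rewrite AD card_in_imset // => e f; rewrite !inE => /andP[ve ce] /andP[vf cf] Eef.
    apply/eqP; case: eqVneq => // ef; have := pc v e f ve vf ef.
    by case: (c e) (c f) ce cf Eef => [x|] // [y|] //= _ _ -> /(_ erefl).
  by rewrite cardsC card_option card_bool.
by rewrite -/A; lia.
Qed.

Lemma missingP c a v :
  reflect (missing c a v) [forall e, inc v e ==> (c e != Some a)].
Proof.
apply: (iffP forallP) => [H e ve|H e]; first by apply/eqP; exact: (implyP (H e)).
by apply/implyP=> ve; apply/eqP; apply: H.
Qed.

Lemma missing_exists c e v : proper c -> c e = None -> inc v e ->
  exists a, missing c a v.
Proof.
move=> pc ce ve; have : 0 < #|[set e | inc v e & c e == None]|.
  by apply/card_gt0P; exists e; rewrite inE ve ce.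
by rewrite -card_missing // => /card_gt0P[a]; rewrite inE => /missingP; exists a.
Qed.

Lemma missing_two c e f v : proper c -> c e = None -> c f = None -> e != f ->
  inc v e -> inc v f -> exists a b, [/\ a <> b, missing c a v & missing c b v].
Proof.
move=> pc ce cf ef ve vf; have : 1 < #|[set e | inc v e & c e == None]|.
  by apply/card_gt1P; exists e, f; rewrite !inE ve vf ce cf.
rewrite -card_missing // => /card_gt1P[a [b []]]; rewrite !inE.
by move=> /missingP ma /missingP mb /eqP; exists a, b.
Qed.

Lemma third_color (a b x y : color) :
  a <> b -> x <> a -> x <> b -> y <> a -> y <> b -> x = y.
Proof. by case: a b x y => [[]|] [[]|] [[]|] [[]|]. Qed.

(** On the chain, [y] would have two chain edges; neither is [e], of which [y] is no end, and
    neither has colour [k], so both would have colour [a]. *)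
Lemma half_chain_end c e f v x y a k : optimal c ->
  state c e v x a k -> state c f v y a k -> x <> y ->
  ~~ connect (gadj (chain c e a k)) v y.
Proof.
move=> oc st1 [cf jf _ my] xy; apply/negP=> /(chain_deg2 oc st1)[g [h [gh gM hM yg yh]]].
have [ce je _ _] := st1.
have col z : z \in chain c e a k -> inc y z -> c z = Some a.
  rewrite inE => zM yz; case/or3P: zM => /eqP // zE; last by case: (my z yz).
  subst z; case: (inc_joins je yz) => [yv|yx]; last by case: xy.
  by have := joins_neq jf; rewrite yv eqxx.
by have := oc.1 _ _ _ yg yh gh; rewrite !col // => /(_ erefl).
Qed.

(* If [e1 = vx] and [e2 = vy] are uncoloured, the intersection [J] of the two
   chains through [v] is a union of two-coloured components missing [x] and [y];
   each vertex of [J] sees both colours, except [v] which sees only one, so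
   counting the edges of either colour makes both [#|J|] and [#|J| - 1] even. *)
Lemma uncolored_matching c e1 e2 v : optimal c -> c e1 = None -> c e2 = None ->
  inc v e1 -> inc v e2 -> e1 = e2.
Proof.
move=> oc ce1 ce2 ve1 ve2; apply/eqP; case: eqVneq => // e12.
have [a [b [ab ma mb]]] := missing_two oc.1 ce1 ce2 e12 ve1 ve2.
have [x j1] := incP ve1; have [y j2] := incP ve2.
have other z w f : c f = None -> joins f v w -> missing c z w -> z <> a /\ z <> b.
  by move=> cf jf mz; split=> zE; subst z; [apply: no_common oc cf jf ma mz | apply: no_common oc cf jf mb mz].
(* If [e1] and [e2] were parallel, their other end would also miss two colours, both different from
   [a] and [b]; only one such colour exists. *)
have xy : x <> y.
  move=> xy; subst y.
  have [p [q [pq mp mq]]] := missing_two oc.1 ce1 ce2 e12 (joins_incr j1) (joins_incr j2).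
  have [pa pb] := other _ _ _ ce1 j1 mp; have [qa qb] := other _ _ _ ce1 j1 mq.
  exact/pq/(third_color ab).
have [k mk] := missing_exists oc.1 ce1 (joins_incr j1).
have [k' mk'] := missing_exists oc.1 ce2 (joins_incr j2).
have [ka kb] := other _ _ _ ce1 j1 mk; have [ka' kb'] := other _ _ _ ce2 j2 mk'.
have kk : k' = k by apply: (third_color ab).
subst k'.
have st1 : state c e1 v x a k by [].
have st2 : state c e2 v y a k by [].
have y1 := half_chain_end oc st1 st2 xy.
have x2 := half_chain_end oc st2 st1 (fun H => xy (esym H)).
set M1 := chain c e1 a k in y1; set M2 := chain c e2 a k in x2.
pose J := [set w | connect (gadj M1) v w && connect (gadj M2) v w].
pose F g := [set h | c h == Some g].
have vJ : v \in J by rewrite inE !connect0.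
have cutF g : (g == a) || (g == k) -> F g :&: cut J = set0.
  move=> gak; apply/setP=> h; rewrite !inE; case: eqP => //= ch.
  have hM e : h \in chain c e a k.
    by rewrite inE ch; case/orP: gak => /eqP->; rewrite eqxx ?orbT.
  have jh : joins h (s h) (t h) by rewrite /Defs.joins !eqxx.
  have same e : connect (gadj (chain c e a k)) v (s h) = connect (gadj (chain c e a k)) v (t h).
    apply: same_connect_r; first exact/sym_connect_sym/gadj_sym.
    by apply/connect1/gadjP; exists h.
  by rewrite !same eqxx.
have one w g h : inc w h -> c h = Some g -> #|[set e in F g | inc w e]| = 1.
  move=> wh ch; apply/eqP/cards1P; exists h; apply/setP=> f; rewrite !inE.
  have [->|fh] := eqVneq f h; first by rewrite ch eqxx wh.
  apply/negP=> /andP[/eqP cf wf].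
  by have := oc.1 _ _ _ wf wh fh; rewrite cf ch => /(_ erefl).
(* Neither of the two chain edges at [w] is [e1]: [w] is not [v], and it is not [x], which lies off
   the second chain. *)
have both w : w \in J -> w != v -> forall g, (g == a) || (g == k) -> exists2 h, inc w h & c h = Some g.
  rewrite inE => /andP[w1 w2] wv g gak.
  have [g' [h [gh gM hM wg wh]]] := chain_deg2 oc st1 w1.
  have col z : z \in M1 -> inc w z -> c z = Some a \/ c z = Some k.
    rewrite inE => zM wz; case/or3P: zM => /eqP // zE; [|by left|by right].
    subst z; case: (inc_joins j1 wz) => wE; first by rewrite wE eqxx in wv.
    by rewrite wE (negPf x2) in w2.
  have ne : c g' <> c h.
    move=> cE; have := oc.1 _ _ _ wg wh gh cE.
    by case: (col _ gM wg) => ->.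
  by case: (col _ gM wg) (col _ hM wh) => cg [] ch; move: ne gak;
    rewrite cg ch // => _ /orP[]/eqP->; [exists g'|exists h|exists h|exists g'].
have [h vh ch] : exists2 h, inc v h & c h = Some k.
  by case: (missing_dec c k v) => // mkv; case: (no_common oc ce1 j1 mkv mk).
have := handshake (F k) J; rewrite cutF ?eqxx ?orbT // cards0 addn0.
rewrite (eq_bigr (fun=> 1)) ?sum1_card => [cJk|w wJ]; last first.
  have [->|wv] := eqVneq w v; first exact: one vh ch.
  by have [|g wg cg] := both w wJ wv k; rewrite ?eqxx ?orbT // (one _ _ _ wg cg).
have := handshake (F a) J; rewrite cutF ?eqxx ?orbT // cards0 addn0.
rewrite (bigD1 v) //= (_ : #|_| = 0); last first.
  apply/eqP; rewrite cards_eq0; apply/eqP/setP=> f; rewrite !inE.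
  by apply/negP=> /andP[/eqP cf vf]; apply: ma vf cf.
rewrite add0n (eq_bigr (fun=> 1)) => [|w /andP[wJ wv]]; last first.
  by have [|g wg cg] := both w wJ wv a; rewrite ?eqxx ?orbT // (one _ _ _ wg cg).
have := cardsD1 v J; rewrite vJ => cJ.
rewrite sum1dep_card (_ : #|_| = #|J :\ v|); last by apply: eq_card=> w; rewrite !inE andbC.
by lia.
Qed.

(** * Disjointness and length of chains *)

(** Rotating the chain to [w] leaves [e'] uncoloured, so two uncoloured edges would meet at [w]. *)
Lemma chain_avoids c e e' u v a b w : optimal c -> state c e u v a b ->
  e' != e -> c e' = None -> connect (gadj (chain c e a b)) u w -> ~ inc w e'.
Proof.
move=> oc st ee' ce' /connectP[p pth ->] we'.
have [c1 [g [v1 [a1 [b1 [o1 s1 ch1 same]]]]]] := rotate oc st pth.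
have [cg /joins_incl wg _ _] := s1.
have e'M : e' \notin chain c e a b by rewrite inE ce' (negPf ee').
have gM : g \in chain c e a b by rewrite -ch1 inE eqxx.
have c1e' : c1 e' = None by rewrite same.
by rewrite (uncolored_matching o1 c1e' cg we' wg) gM in e'M.
Qed.

(** Shift [e] along the path [p]. The second state survives each step, and at the end [last u p] is
    an end of the current uncoloured edge, which the second chain avoids. *)
Lemma chains_disjoint p c e u v a b e' u' v' a' b' : optimal c ->
  state c e u v a b -> state c e' u' v' a' b' -> e != e' ->
  path (gadj (chain c e a b)) u p ->
  ~~ connect (gadj (chain c e' a' b')) u' (last u p).
Proof.
elim: p c e u v a b => [|y p IH] c e u v a b oc st st' ee'.
all: have [ce j mu mv] := st; have [ce' j' mu' mv'] := st'.
all: have away w := chain_avoids (w := w) oc st' ee' ce.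
- by move=> _; apply/negP=> /away; apply; apply: joins_incl j.
case/andP=> /gadjP[g gM jg] pth /=.
have [gE|ge] := eqVneq g e.
  subst g; rewrite -(joins_fun j jg) in pth *.
  rewrite chainC in pth *; exact: (IH _ _ _ _ _ _ oc (state_flip st)).
have [f [x [[fe cf jf oc1 st1] chE]]] := moveP oc st.
have gf : g = f.
  move: gM; rewrite inE (negPf ge) /= => /orP[]/eqP cg.
    by case: (mu g (joins_incl jg)).
  apply/eqP; case: eqVneq => // gf.
  by have := oc.1 _ _ _ (joins_incl jg) (joins_incl jf) gf; rewrite cg cf; move/(_ erefl).
subst g; rewrite -(joins_fun jf jg) in pth *.
rewrite -chE in pth.
have fe' : f != e' by apply/eqP=> fE; rewrite fE ce' in cf.
set M' := chain c e' a' b'.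
have v'M : connect (gadj M') u' v'.
  by apply/connect1/gadjP; exists e'; rewrite // inE eqxx.
have missing1 w z : connect (gadj M') u' w -> missing c z w -> missing (move c e f b) z w.
  move=> uw mz h wh; rewrite /move; case: eqVneq => [hE|_].
    by subst h; case: (away w uw).
  by case: eqVneq => // _; apply: mz.
have st1' : state (move c e f b) e' u' v' a' b'.
  by split; rewrite // /move; [rewrite eq_sym (negPf ee') eq_sym (negPf fe') | apply: missing1 | apply: missing1].
have := IH _ _ _ _ _ _ oc1 st1 st1' fe' pth; apply: contra.
(* A path of the second chain uses neither [e] nor [f], as both contain [u], so it is still a path
   after the shift. *)
case/connectP=> q pq ->; apply/connectP; exists q => //.
have conn : all (connect (gadj M') u') (u' :: q) by by apply/allP=> w; exact: (path_connect pq).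
apply: sub_in_path conn pq => w w' /= uw uw' /gadjP[h hM jh]; apply/gadjP; exists h => //.
have he : h != e by apply/eqP=> hE; subst h; apply: (away w uw (joins_incl jh)).
have hf : h != f.
  apply/eqP=> hE; subst h; case: (inc_joins jh (joins_incl jf)) => uE; subst.
    exact: (away _ uw (joins_incl j)).
  exact: (away _ uw' (joins_incl j)).
by move: hM; rewrite !inE /move (negPf he) (negPf hf).
Qed.

(** The chain contains [e = uv], a [b]-edge [ux] and an [a]-edge [vq]. If every vertex is the centre
    of a claw, [x] and [q] differ, and the [a]-edge at [x] leads to a fifth vertex [r]. *)
Lemma chain_card c e u v a b : optimal c -> state c e u v a b ->
  3 <= #|[set w | connect (gadj (chain c e a b)) u w]| /\
  ((forall w, ~ not_claw_center w) ->
   5 <= #|[set w | connect (gadj (chain c e a b)) u w]|).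
Proof.
move=> oc st; have [ce j mu mv] := st.
set K := [set w | _]; set M := chain c e a b in K *.
have step w w' h : w \in K -> h \in M -> joins h w w' -> w' \in K.
  rewrite !inE => uw hM jh; apply: connect_trans uw _.
  by apply/connect1/gadjP; exists h => //; rewrite inE.
have uK : u \in K by rewrite inE connect0.
have eM : e \in M by rewrite inE eqxx.
have vK : v \in K by apply: step uK eM j.
have [f [x [[fe cf jf _ _] _]]] := moveP oc st.
have fM : f \in M by rewrite inE cf eqxx !orbT.
have xK : x \in K by apply: step uK fM jf.
have uv := joins_neq j; have ux := joins_neq jf.
have vx : v != x by apply/eqP=> vE; subst x; case: (mv f (joins_incr jf)).
split.
  apply/card_geqP; exists [:: u; v; x]; split=> //; first by rewrite /= !inE negb_or uv ux vx.
  by apply/allP; rewrite /= uK vK xK.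
move=> claws; have [g [q [[ge cg jg _ _] _]]] := moveP oc (state_flip st).
have gM : g \in M by rewrite inE cg eqxx orbT.
have qK : q \in K by apply: step vK gM jg.
have vq := joins_neq jg.
have uq : u != q by apply/eqP=> uE; subst q; case: (mu g (joins_incr jg)).
(* Otherwise [u], [v], [x] form a triangle. *)
have xq : x != q.
  apply/eqP=> xE; subst q; apply: (claws u); exists e, f, v, x.
  by split; rewrite // 1?eq_sym //; right; exists g.
(* If [a] were missing at [x], both chain edges there would have colour [b]. *)
have [h xh ch] : exists2 h, inc x h & c h = Some a.
  case: (missing_dec c a x) => // mx.
  have ux' : connect (gadj M) u x by have := xK; rewrite inE.
  have [h1 [h2 [h12 h1M h2M xh1 xh2]]] := chain_deg2 oc st ux'.
  have col z : z \in M -> inc x z -> c z = Some b.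
    rewrite inE => zM xz; case/or3P: zM => /eqP // zE; last by case: (mx z xz).
    by subst z; case: (inc_joins j xz) => xE; subst x; [rewrite eqxx in ux|rewrite eqxx in vx].
  by have := oc.1 _ _ _ xh1 xh2 h12; rewrite !col // => /(_ erefl).
have [r jr] := incP xh.
have hM : h \in M by rewrite inE ch eqxx orbT.
have rK : r \in K by apply: step xK hM jr.
have xr := joins_neq jr.
have ur : u != r by apply/eqP=> uE; subst r; case: (mu h (joins_incr jr)).
have hg w : inc w h -> inc w g -> h = g.
  move=> wh wg; apply/eqP; case: eqVneq => // hg.
  by have := oc.1 _ _ _ wh wg hg; rewrite ch cg => /(_ erefl).
have hng : h <> g.
  move=> hE; subst h; case: (inc_joins jg xh) => xE; subst x; first by rewrite eqxx in vx.
  by rewrite eqxx in xq.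
have vr : v != r.
  by apply/eqP=> vE; subst r; apply/hng/(hg v); [apply: joins_incr jr|apply: joins_incl jg].
have qr : q != r.
  by apply/eqP=> vE; subst r; apply/hng/(hg q); [apply: joins_incr jr|apply: joins_incr jg].
apply/card_geqP; exists [:: u; v; x; q; r]; split=> //.
  by rewrite /= !inE !negb_or uv ux uq ur vx vq vr xq xr qr.
by apply/allP; rewrite /= uK vK xK qK rK.
Qed.

(** * Optimal colourings and the weighted count of uncoloured edges *)

Lemma optimal_exists : exists c, optimal c.
Proof.
have pN : proper (fun=> None) by [].
pose P n := [exists c : {ffun E -> option color}, [forall v, forall e, forall f,
  [&& inc v e, inc v f, e != f & c e == c f] ==> (c e == None)] && (uncolored c == n)].
have PP c : proper c -> P (uncolored c).
  move=> pc; apply/existsP; exists [ffun e => c e]; apply/andP; split.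
    apply/forallP=> v; apply/forallP=> e; apply/forallP=> f; apply/implyP.
    by rewrite !ffunE => /and4P[ve vf ef /eqP cE]; apply/eqP/(pc v e f).
  by apply/eqP/eq_card=> e; rewrite !inE ffunE.
have exP : exists n, P n by exists (uncolored (fun=> None)); apply: PP.
have [n /existsP[c /andP[/forallP pc /eqP cn]] nmin] := ex_minnP exP.
exists c; split; last by move=> c' /PP /nmin; rewrite cn.
move=> v e f ve vf ef cE; apply/eqP.
by have /forallP/(_ e)/forallP/(_ f) := pc v; rewrite ve vf ef cE eqxx.
Qed.

(** The chains of distinct uncoloured edges are vertex-disjoint, so their weights add up to at most
    the total. *)
Lemma few_uncolored (w : V -> nat) m c : optimal c ->
  (forall e u v a b, state c e u v a b ->
     m <= \sum_(x | connect (gadj (chain c e a b)) u x) w x) ->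
  m * uncolored c <= \sum_x w x.
Proof.
move=> oc large.
pose miss x := odflt None [pick a : color | [forall f, inc x f ==> (c f != Some a)]].
have missE e x : c e = None -> inc x e -> missing c (miss x) x.
  move=> ce xe; have [a ma] := missing_exists oc.1 ce xe.
  by apply/missingP; rewrite /miss; case: pickP => //= /(_ a)/missingP.
have stE e : c e = None -> state c e (s e) (t e) (miss (s e)) (miss (t e)).
  move=> ce; have j : joins e (s e) (t e) by rewrite /Defs.joins !eqxx.
  by split=> //; apply: missE ce _; [apply: joins_incl j | apply: joins_incr j].
pose K e := [pred x | connect (gadj (chain c e (miss (s e)) (miss (t e)))) (s e) x].
have disj e f x : c e = None -> c f = None -> x \in K e -> x \in K f -> e = f.
  move=> ce cf /connectP[p pth ->] xf; apply/eqP; apply: contraLR xf => ef.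
  exact: chains_disjoint oc (stE _ ce) (stE _ cf) ef pth.
apply: (@leq_trans (\sum_(e | c e == None) \sum_(x | x \in K e) w x)).
  rewrite /uncolored -sum1dep_card big_distrr /=.
  by apply: leq_sum => e /eqP ce; rewrite muln1; apply: large (stE _ ce).
under eq_bigr => e _ do rewrite big_mkcond.
rewrite exchange_big /=; apply: leq_sum => x _.
rewrite -big_mkcondr /=.
have [e /andP[/eqP ce xe]|none] := pickP [pred e | (c e == None) && (x \in K e)].
  rewrite (big_pred1 e) // => f; apply/andP/eqP => [[/eqP cf xf]|->]; first exact: (disj f e x).
  by rewrite ce.
by rewrite big_pred0.
Qed.

(** With at most two vertices there is no room for a chain, hence no uncoloured edge; otherwise a
    chain has at least five vertices of weight at least 3, giving 15. *)
Lemma proper_few_uncolored (w : V -> nat) :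
  #|V| <= 2 \/ (forall v, ~ not_claw_center v) /\ (forall v, 3 <= w v) ->
  exists2 c, proper c & 15 * uncolored c <= \sum_x w x.
Proof.
move=> H; have [c oc] := optimal_exists; exists c; first exact: oc.1.
apply: (few_uncolored oc) => e u v a b st.
have [c3 c5] := chain_card oc st.
case: H => [V2|[claws w3]].
  by have := leq_trans c3 (leq_trans (max_card _) V2).
have := c5 claws; rewrite cardsE => {}c5.
apply: (@leq_trans (\sum_(x | connect (gadj (chain c e a b)) u x) 3)); last first.
  exact: leq_sum.
by rewrite sum_nat_const; move: c5; rewrite -[#|[pred _ | _]|]/#|connect _ _|; lia.
Qed.

(** * Three vertices spanning at least three edges *)

Definition inner (X : {set V}) := [set e | (s e \in X) && (t e \in X)].

Lemma inner_cut (X : {set V}) : 3 * #|X| = 2 * #|inner X| + #|cut X|.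
Proof.
have := handshake setT X.
rewrite setTI (_ : [set e in setT | _] = inner X); last by apply/setP=> e; rewrite !inE.
move=> <-; rewrite -sum1_card big_distrr /=; apply: eq_bigr => v _.
by rewrite muln1 -(cubic_st v); apply: eq_card=> e; rewrite !inE.
Qed.

Lemma inner_joins (X : {set V}) e u v : joins e u v -> u \in X -> v \in X -> e \in inner X.
Proof. by rewrite inE; case/joins_st=> -[-> ->] -> ->. Qed.

(** A triangle serves directly. To a digon [vp] add the other end of the third edge at [v], or any
    further vertex if that edge is parallel too. *)
Lemma not_claw_dense v : not_claw_center v -> 3 <= #|V| ->
  exists2 X : {set V}, #|X| = 3 & 3 <= #|inner X|.
Proof.
case=> e [f [p [q [ef je jf]]]].
have vp := joins_neq je; have vq := joins_neq jf.
have three (x z : V) : v != x -> v != z -> x != z ->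
    (exists e1 e2 e3, [/\ e1 \in inner [set v; x; z], e2 \in inner [set v; x; z]
      & e3 \in inner [set v; x; z]] /\ [/\ e1 != e2, e2 != e3 & e3 != e1]) ->
    exists2 X : {set V}, #|X| = 3 & 3 <= #|inner X|.
  move=> vx vz xz /card_gt2P; exists [set v; x; z] => //.
  by rewrite -setUA !cardsU1 cards1 !inE negb_or vx vz xz.
have [pq|pq] := eqVneq p q; last first.
  case=> [pE _|[g jg] _]; first by rewrite pE eqxx in pq.
  apply: (three p q) => //; exists e, f, g; split.
    by split; [apply: inner_joins je _ _|apply: inner_joins jf _ _|apply: inner_joins jg _ _];
      rewrite !inE eqxx ?orbT.
  split=> //.
    apply/eqP=> fg; case: (inc_joins jg (_ : inc v g)) => [|vE|vE].
    - by rewrite -fg (joins_incl jf).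
    - by rewrite vE eqxx in vp.
    - by rewrite vE eqxx in vq.
  apply/eqP=> fg; case: (inc_joins jg (_ : inc v g)) => [|vE|vE].
  - by rewrite fg (joins_incl je).
  - by rewrite vE eqxx in vp.
  - by rewrite vE eqxx in vq.
subst q => _ V3.
have [h [vh he hf]] : exists h, [/\ inc v h, e != h & f != h].
  have : 0 < #|[set h | inc v h] :\ e :\ f|.
    have := cubic_st v; rewrite /degree (cardsD1 e) (cardsD1 f (_ :\ e)).
    rewrite !inE (joins_incl je) (joins_incl jf).
    by rewrite [f == e]eq_sym ef /= => H; rewrite -ltnS -[_.+1]add1n; move: H; lia.
  by case/card_gt0P=> h; rewrite !inE eq_sym [h == e]eq_sym => /and3P[]; exists h.
have [y jh] := incP vh.
have [z [vz pz yX]] : exists z, [/\ v != z, p != z & y \in [set v; p; z]].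
  have [yp|yp] := eqVneq p y; last by exists y; rewrite !inE eqxx !orbT (joins_neq jh) yp.
  have : 0 < #|~: [set v; p]| by rewrite cardsCs setCK cards2 vp; lia.
  by case/card_gt0P=> z; rewrite !inE negb_or => /andP[zv zp]; exists z;
    rewrite !inE -yp eqxx !orbT eq_sym zv eq_sym zp.
apply: (three p z) => //; exists e, f, h; split; last by rewrite ef hf eq_sym he.
by split; [apply: inner_joins je _ _|apply: inner_joins jf _ _|apply: inner_joins jh _ _];
  rewrite // !inE eqxx ?orbT.
Qed.

End Kempe.

(** * Finite-set tools for lifting colourings *)

(** Each element of a fibre of [l] goes to the element at the same position in the fibre of [m] with
    the same label. *)
Lemma fiber_bijection (T L : finType) (A B : {set T}) (l m : T -> L) :
  (forall x, #|[set e in A | l e == x]| = #|[set e in B | m e == x]|) ->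
  exists phi : T -> T, {in A, forall e, phi e \in B /\ m (phi e) = l e} /\ {in A &, injective phi}.
Proof.
move=> cAB; pose fA e := enum [set f in A | l f == l e]; pose fB e := enum [set f in B | m f == l e].
pose phi e := nth e (fB e) (index e (fA e)).
have ltB e : e \in A -> index e (fA e) < size (fB e).
  by move=> eA; rewrite -cardE -cAB cardE index_mem /fA mem_enum inE eA /=.
have phiB e : e \in A -> phi e \in B /\ m (phi e) = l e.
  move=> eA; have : phi e \in fB e by apply: mem_nth; apply: ltB.
  by rewrite /fB mem_enum inE => /andP[? /eqP].
exists phi; split=> // e f eA fA' E.
have lef : l e = l f by rewrite -(phiB e eA).2 E (phiB f fA').2.
have := ltB f fA'; have := ltB e eA; move: E; rewrite /phi /fA /fB lef => E lt1 lt2.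
move: E; rewrite (set_nth_default f) // => /eqP; rewrite nth_uniq ?enum_uniq // => /eqP iE.
have mA g : g \in A -> l g = l f -> g \in enum [set f0 in A | l f0 == l f].
  by move=> gA lg; rewrite mem_enum inE gA lg /=.
by rewrite -(nth_index e (mA e eA lef)) iE nth_index // mA.
Qed.

(** Colours are chosen for [x], [y], [z] in turn, avoiding those already chosen and those prescribed
    later. Applied to the three cut edges, this reserves distinct colours even for uncoloured
    ones. *)
Lemma extend_coloring (T : finType) (O : {set T}) (c : T -> option color) : #|O| = 3 ->
  {in O &, forall f g, f != g -> c f = c g -> c f = None} ->
  exists k : T -> color, {in O &, injective k} /\ {in O, forall f, c f = None \/ c f = Some (k f)}.
Proof.
move=> O3 pc; have /card_gt2P[x [y [z [[xO yO zO] [xy yz zx]]]]] : 2 < #|O| by rewrite O3.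
have OE : O = [set x; y; z].
  apply/esym/eqP; rewrite eqEcard O3; apply/andP; split.
    by apply/subsetP=> u; rewrite !inE => /orP[/orP[]|]/eqP->.
  by rewrite -setUA !cardsU1 cards1 !inE negb_or xy yz eq_sym zx.
have fill (p q : option color) : exists a : color, Some a <> p /\ Some a <> q.
  by case: p q => [[[]|]|] [[[]|]|]; first [by exists None | by exists (Some true) | by exists (Some false)].
have [a [aE ay az]] : exists a : color, [/\ c x = None \/ c x = Some a, Some a <> c y & Some a <> c z].
  case cx : (c x) => [a|]; last by have [a [? ?]] := fill (c y) (c z); exists a; split=> //; left.
  exists a; split; [by right| |] => Ea; have := pc x.
    by move=> /(_ y xO yO xy); rewrite cx -Ea => /(_ erefl).
  by rewrite eq_sym in zx; move=> /(_ z xO zO zx); rewrite cx -Ea => /(_ erefl).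
have [b [bE ba bz]] : exists b : color, [/\ c y = None \/ c y = Some b, b <> a & Some b <> c z].
  case cy : (c y) => [b|]; last first.
    by have [b [? ?]] := fill (Some a) (c z); exists b; split=> //; [left|move=> ba; subst b].
  exists b; split; [by right| |] => Ea; first by case: ay; rewrite cy Ea.
  by have := pc y z yO zO yz; rewrite cy -Ea => /(_ erefl).
have [d [dE da db]] : exists d : color, [/\ c z = None \/ c z = Some d, d <> a & d <> b].
  case cz : (c z) => [d|]; last first.
    by have [d [? ?]] := fill (Some a) (Some b); exists d; split=> //; [left|move=> E; subst d|move=> E; subst d].
  by exists d; split; [by right| |] => Ea; [case: az|case: bz]; rewrite cz Ea.
exists (fun u => if u == x then a else if u == y then b else d).
rewrite eq_sym in zx.
split=> [f g|f]; rewrite OE !inE; last first.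
  by move=> /orP[/orP[]|]/eqP->; rewrite ?eqxx // 1?[y == x]eq_sym ?(negPf xy) ?eqxx // ![z == _]eq_sym (negPf zx) (negPf yz).
have zE : (z == x = false) * (z == y = false) * (y == x = false).
  by rewrite ![z == _]eq_sym [y == x]eq_sym (negPf zx) (negPf yz) (negPf xy).
by move=> /orP[/orP[]|]/eqP-> /orP[/orP[]|]/eqP->; rewrite ?eqxx ?zE ?eqxx => E; congruence.
Qed.

Lemma card_sig_set (T : finType) (P Q : pred T) :
  #|[set x : {x | P x} | Q (val x)]| = #|[set x | P x && Q x]|.
Proof.
rewrite -(card_imset _ val_inj); apply: eq_card => x; rewrite inE.
apply/imsetP/andP => [[[y Py]]|[Px Qx]]; first by rewrite inE => Qy ->.
by exists (exist _ x Px); rewrite ?inE.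
Qed.

(** * Contracting three vertices with a cut of three edges *)

Section Contraction.
Variables (V E : finType) (s t : E -> V) (X : {set V}).
Hypotheses (loopless_st : loopless s t) (cubic_st : cubic s t).
Hypotheses (X3 : #|X| = 3) (cutX : #|cut s t X| = 3).
Local Notation inc := (incident s t).
Local Notation I := (inner s t X).
Local Notation O := (cut s t X).

(** The contracted vertex is [None]; edges inside [X] are dropped, so no loops arise. *)
Definition contract (v : V) : option {v | v \notin X} := insub v.
Definition contract_src (e : {e | e \notin I}) := contract (s (val e)).
Definition contract_tgt (e : {e | e \notin I}) := contract (t (val e)).
Local Notation s' := contract_src.
Local Notation t' := contract_tgt.

Lemma contract_eqNone x : (contract x == None) = (x \in X).
Proof. by rewrite /contract; case: insubP => [u /negPf-> _|/negbNE->]. Qed.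

Lemma contract_eqSome x v : (contract x == Some v) = (x == val v).
Proof.
rewrite /contract; case: insubP => [u _ <-|xX] //=.
by apply/esym/negP=> /eqP xv; case/negP: xX; rewrite xv (valP v).
Qed.

Lemma contract_eq x y : (contract x == contract y) = (x == y) || (x \in X) && (y \in X).
Proof.
case cy : (contract y) => [v|].
  rewrite contract_eqSome.
  have := contract_eqSome y v; rewrite cy eqxx => /esym/eqP->.
  by rewrite (negPf (valP v)) andbF orbF.
rewrite contract_eqNone; have := contract_eqNone y; rewrite cy eqxx => /esym yX.
by rewrite yX andbT; case: eqP => [->|].
Qed.

Lemma contract_loopless : loopless s' t'.
Proof.
move=> [e eI]; rewrite /s' /t' contract_eq negb_or (loopless_st e) /=.
by move: eI; rewrite inE.
Qed.

Lemma card_inner : #|I| = 3.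
Proof. by have := inner_cut loopless_st cubic_st X; rewrite X3 cutX; lia. Qed.

Lemma contract_cubic : cubic s' t'.
Proof.
move=> [v|].
  rewrite -(cubic_st (val v)) /degree.
  rewrite (_ : [set e | _] = [set e | inc (val v) (val e)]); last first.
    by apply/setP=> e; rewrite !inE /incident !contract_eqSome.
  rewrite (card_sig_set _ (inc (val v))); apply: eq_card => e; rewrite !inE.
  apply: andb_idl; have := valP v; rewrite /incident => vX.
  by case/orP=> /eqP->; rewrite (negPf vX) ?andbF.
rewrite /degree -cutX.
rewrite (_ : [set e | _] = [set e | (s (val e) \in X) || (t (val e) \in X)]); last first.
  by apply/setP=> e; rewrite !inE /incident !contract_eqNone.
rewrite (card_sig_set _ (fun e => (s e \in X) || (t e \in X))); apply: eq_card => e; rewrite !inE.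
by case: (s e \in X); case: (t e \in X).
Qed.

(** Edges inside [X] never cross the preimage of [S]. Hence contraction creates no 1-edge cut. *)
Lemma contract_cut (S : {set option {v | v \notin X}}) :
  #|cut s' t' S| = #|cut s t (contract @^-1: S)|.
Proof.
rewrite (card_sig_set _ (fun e => (contract (s e) \in S) != (contract (t e) \in S))).
apply: eq_card => e; rewrite !inE; apply: andb_idl; apply: contra => /andP[sX tX].
by have /eqP-> : contract (s e) == contract (t e) by rewrite contract_eq sX tX orbT.
Qed.

Lemma contract_joins e (eI : e \notin I) u v :
  joins s t e u v -> joins s' t' (exist _ e eI) (contract u) (contract v).
Proof.
by case/joins_st=> -[<- <-]; rewrite /joins /s' /t' /= !eqxx ?orbT.
Qed.

Lemma notin_inner v e : v \notin X -> inc v e -> e \notin I.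
Proof. by rewrite inE => vX /orP[]/eqP->; rewrite (negPf vX) ?andbF. Qed.

(** The edges at [v] survive; if the third side of a triangle lies inside [X], its ends merge and a
    digon results. *)
Lemma contract_not_claw v : v \notin X -> not_claw_center s t v ->
  not_claw_center s' t' (contract v).
Proof.
move=> vX [e [f [p [q [ef je jf pq]]]]].
have eI := notin_inner vX (joins_incl je); have fI := notin_inner vX (joins_incl jf).
exists (exist _ e eI), (exist _ f fI), (contract p), (contract q); split => //.
- exact: contract_joins.
- exact: contract_joins.
case: pq => [->|[g jg]]; first by left.
have [gI|gI] := boolP (g \in I); last by right; exists (exist _ g gI); apply: contract_joins.
left; apply/eqP; rewrite contract_eq; apply/orP; right.
by move: gI; rewrite inE andbC; case/joins_st: jg => -[-> ->] // /andP[-> ->].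
Qed.

(* The three internal edges are matched with the three cut edges so that matched
   edges are not adjacent: at each vertex of [X] the number of cut edges equals
   the number of internal edges avoiding that vertex. *)
Lemma inner_cut_matching : exists phi : E -> E,
  [/\ {in I, forall e, phi e \in O}, {in I &, injective phi} &
      {in I, forall e x, x \in X -> inc x e -> ~~ inc x (phi e)}].
Proof.
have avoid e : e \in I -> exists2 z, z \in X & forall x, x \in X -> ~~ inc x e = (z == x).
  rewrite inE => /andP[sX tX].
  have : #|X :\ s e :\ t e| = 1.
    have := cardsD1 (t e) (X :\ s e); have := cardsD1 (s e) X.
    by rewrite X3 sX !inE tX eq_sym loopless_st /=; lia.
  case/eqP/cards1P=> z Xz; exists z.
    have : z \in X :\ s e :\ t e by rewrite Xz set11.
    by rewrite !inE => /and3P[].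
  move=> x xX; have : (x \in X :\ s e :\ t e) = (x == z) by rewrite Xz in_set1.
  rewrite !inE xX andbT eq_sym [z == x]eq_sym => <-.
  by rewrite /incident negb_or andbC ![x == _]eq_sym.
(* The label of an inner edge is the vertex of [X] it avoids; below, [m] labels a cut edge by its
   end in [X]. *)
pose l e := odflt (s e) [pick x in X | ~~ inc x e].
have lE e x : e \in I -> (l e == x) = (x \in X) && ~~ inc x e.
  move=> eI; have [z zX ze] := avoid e eI; rewrite /l.
  case: pickP => [y /andP[yX]|/(_ z)] /=; last by rewrite zX ze ?eqxx.
  by rewrite ze // => /eqP<-; case: (boolP (x \in X)) => [/ze->//|]; case: eqP => [<-|//]; rewrite zX.
pose m f := if s f \in X then s f else t f.
have mE f x : f \in O -> (m f == x) = (x \in X) && inc x f.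
  rewrite inE /m /incident; case: ifP => sX; case tX: (t f \in X) => // _.
    by have [<-|_] := eqVneq (s f) x; rewrite ?sX //=; case: eqVneq => [<-|_]; rewrite ?tX ?andbF.
  by have [<-|_] := eqVneq (t f) x; rewrite ?tX ?orbT //= orbF; case: eqVneq => [<-|_]; rewrite ?sX ?andbF.
have [|phi [phiO phi_inj]] := @fiber_bijection E V I O l m.
  move=> x; have [xX|xX] := boolP (x \in X); last first.
    by rewrite !eq_card0 // => f; rewrite !inE; apply/negP=> /andP[fI]; rewrite ?lE ?mE ?inE ?(negPf xX).
  have -> : #|[set e in I | l e == x]| = #|I :\: [set e | inc x e]|.
    by apply: eq_card => e; rewrite [LHS]in_set in_setD [e \in [set e | _]]in_set;
      have [eI|] := boolP (e \in I); rewrite ?andbF // lE // xX andbT.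
  have -> : #|[set f in O | m f == x]| = #|O :&: [set e | inc x e]|.
    by apply: eq_card => e; rewrite in_setI [LHS]in_set [e \in [set e | _]]in_set;
      have [eI|] := boolP (e \in O); rewrite ?andbF // mE // xX.
  have := cubic_st x; rewrite /degree -/inc => degx.
  (* Since [#|I|] is also 3, the inner edges avoiding [x] are as many as the cut edges at [x]. *)
  have : #|I :&: [set e | inc x e]| + #|O :&: [set e | inc x e]| = 3.
    rewrite -degx -(cardsID I [set e | inc x e]); congr (_ + _); apply: eq_card => e.
      by rewrite !inE andbC.
    rewrite !inE; case xe: (inc x e); rewrite ?andbF // ?andbT.
    by case/orP: xe => /eqP->; rewrite xX; case: (_ \in X).
  by have := cardsID [set e | inc x e] I; rewrite card_inner; lia.
exists phi; split=> [e /phiO[]//|//|e eI x xX xe].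
have [pO pl] := phiO e eI.
by have := lE e x eI; rewrite -pl mE // xX xe /= => ->.
Qed.

(** Each inner edge takes the colour reserved for its matched cut edge. Inner edges thus get
    distinct colours, and a cut edge adjacent to an inner edge is not its match, so it has another
    colour or none. *)
Lemma contract_lift c' : proper s' t' c' ->
  exists2 c, proper s t c & uncolored c = uncolored c'.
Proof.
move=> pc'; have [phi [phiO phi_inj phiN]] := inner_cut_matching.
pose c0 e : option color := if insub e is Some e' then c' e' else None.
have c0E e (eI : e \notin I) : c0 e = c' (exist _ e eI) by rewrite /c0 insubT.
have OI e : e \in O -> e \notin I.
  by rewrite !inE; case: (s e \in X); case: (t e \in X).
have c0O : {in O &, forall f g, f != g -> c0 f = c0 g -> c0 f = None}.
  move=> f g fO gO fg; rewrite (c0E f (OI f fO)) (c0E g (OI g gO)) => cfg.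
  have atX h (hO : h \in O) : incident s' t' None (exist _ h (OI h hO)).
    rewrite /incident !contract_eqNone /=.
    by move: hO; rewrite inE; case: (s h \in X); case: (t h \in X).
  exact: pc' (atX f fO) (atX g gO) _ cfg.
have [k [k_inj kE]] := extend_coloring cutX c0O.
pose c e := if e \in I then Some (k (phi e)) else c0 e.
exists c.
  have mixed v e f : inc v e -> inc v f -> e \in I -> f \notin I -> c0 f <> Some (k (phi e)).
    move=> ve vf eI fI cf.
    have vX : v \in X by move: eI; rewrite inE; case/orP: ve => /eqP<- /andP[].
    have fO : f \in O.
      by move: fI vf; rewrite !inE => fI /orP[]/eqP fv; move: fI; rewrite fv vX; case: (_ \in X).
    case: (kE f fO); rewrite cf // => -[/esym/k_inj kk].
    by have := phiN e eI v vX ve; rewrite -kk ?vf // phiO.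
  move=> v e f ve vf ef; rewrite /c.
  have [eI|eI] := boolP (e \in I); have [fI|fI] := boolP (f \in I).
  - by move=> [/k_inj kk]; have := phi_inj e f eI fI (kk (phiO e eI) (phiO f fI)) => fe; rewrite fe eqxx in ef.
  - by move/esym/(mixed v e f ve vf eI fI).
  - by move/(mixed v f e vf ve fI eI).
  rewrite (c0E e eI) (c0E f fI); apply: (pc' (contract v)) => //.
  + by rewrite /incident; case/orP: ve => /eqP<-; rewrite /s' /t' eqxx ?orbT.
  + by rewrite /incident; case/orP: vf => /eqP<-; rewrite /s' /t' eqxx ?orbT.
rewrite /uncolored -(card_imset _ val_inj); apply: eq_card => e; rewrite inE /c.
apply/idP/imsetP => [|[[g gI]]]; last by rewrite inE => /eqP cg ->; rewrite /= (negPf gI) (c0E g gI) cg.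
by have [//|eI] := boolP (e \in I); rewrite (c0E e eI) => ce; exists (exist _ e eI); rewrite ?inE.
Qed.

End Contraction.

(** * Induction by contraction *)

Lemma not_claw_center_dec (V E : finType) (s t : E -> V) :
  (forall v, ~ not_claw_center s t v) \/ exists v, not_claw_center s t v.
Proof.
have [/existsP[v /existsP[e /existsP[f /existsP[p /existsP[q /and4P[ef je jf pq]]]]]]|none] :=
  boolP [exists v, exists e, exists f, exists p, exists q,
    [&& e != f, joins s t e v p, joins s t f v q & (p == q) || [exists g, joins s t g p q]]].
  right; exists v, e, f, p, q; split=> //.
  by case/orP: pq => [/eqP|/existsP]; [left|right].
left=> v [e [f [p [q [ef je jf pq]]]]]; case/negP: none.
apply/existsP; exists v; apply/existsP; exists e; apply/existsP; exists f.
apply/existsP; exists p; apply/existsP; exists q; rewrite ef je jf /=.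
by case: pq => [->|[g jg]]; rewrite ?eqxx //; apply/orP; right; apply/existsP; exists g.
Qed.

(* For the original graph all weights are 1; the last hypothesis says that only
   contracted vertices may be centres of claws, and is preserved by contraction. *)
Lemma weighted_bound n (V E : finType) (s t : E -> V) (w : V -> nat) : #|V| <= n ->
  loopless s t -> cubic s t -> (forall S : {set V}, #|cut s t S| != 1) ->
  (forall v, 1 <= w v) -> (forall v, 3 <= w v \/ not_claw_center s t v) ->
  exists2 c, proper s t c & 15 * uncolored c <= \sum_v w v.
Proof.
elim: n V E s t w => [|n IH] V E s t w Vn lst cst cuts w1 w3.
  by apply: proper_few_uncolored => //; left; apply: leq_trans Vn _.
have [V2|V3] := leqP #|V| 2; first by apply: proper_few_uncolored => //; left.
have [claws|[v nv]] := not_claw_center_dec s t.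
  by apply: proper_few_uncolored => //; right; split=> // v; case: (w3 v) => // /claws.
have [X X3 IX] := not_claw_dense lst cst nv V3.
(* Here 9 is twice the number of inner edges plus the cut size; with at least three inner edges the
   cut has size 3 or 1, and 1 is excluded. *)
have cutX : #|cut s t X| = 3.
  by have := inner_cut lst cst X; have := cuts X; rewrite X3; lia.
pose w' (v' : option {v | v \notin X}) := \sum_(v | contract X v == v') w v.
have w'_ge v0 : w v0 <= w' (contract X v0) by rewrite /w' (bigD1 v0) //= leq_addr.
have w'1 v' : 1 <= w' v' /\ (3 <= w' v' \/ not_claw_center (@contract_src V E s t X) (@contract_tgt V E s t X) v').
  case: v' => [u|].
    have uE : contract X (val u) = Some u by apply/eqP; rewrite contract_eqSome.
    rewrite -uE; split; first exact: (leq_trans (w1 (val u))).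
    case: (w3 (val u)) => [w3u|nu]; first by left; apply: (leq_trans w3u).
    by right; apply: (contract_not_claw (valP u) nu).
  have w'N : 3 <= w' None.
    rewrite /w' -X3 -sum1_card [Y in _ <= Y](eq_bigl (mem X)) => [|x]; last by rewrite contract_eqNone.
    by apply: leq_sum.
  by split; [apply: (leq_trans _ w'N) | left].
have V'n : #|{: option {v | v \notin X}}| <= n.
  rewrite card_option card_sig; have := cardC X; rewrite X3.
  by rewrite (@eq_card _ [predC X] [pred x | x \notin X]) //; move: Vn; lia.
have [S|v'|v'|c' pc' uc'] := IH _ _ _ _ w' V'n (contract_loopless lst) (contract_cubic cst cutX).
- by rewrite contract_cut; apply: cuts.
- by case: (w'1 v').
- by case: (w'1 v').
have [c pc cE] := contract_lift lst cst X3 cutX pc'.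
exists c => //; rewrite cE; apply: leq_trans uc' _.
(* Contraction preserves the total weight. *)
by rewrite [X in _ <= X](partition_big (contract X) predT).
Qed.


(** * Consequences of bridgelessness and claw-freeness *)

(** Deleting the only edge [e] of a cut separates its ends. The component roots after deletion then
    map onto those before it, but not injectively, so [e] is a bridge. *)
Lemma bridgeless_cut (V E : finType) (s t : E -> V) (S : {set V}) :
  bridgeless s t -> #|cut s t S| != 1.
Proof.
move=> bl; apply/negP=> /cards1P[e cutE]; case/negP: (bl e); rewrite /is_bridge /ncomp.
set R := gadj s t _; set R' := gadj s t _.
have symR : connect_sym R by apply/sym_connect_sym/gadj_sym.
have symR' : connect_sym R' by apply/sym_connect_sym/gadj_sym.
have sub x y : connect R' x y -> connect R x y.
  apply: connect_sub => a b /gadjP[g _ jg]; apply/connect1/gadjP; exists g; by rewrite ?inE.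
have st_S : (s e \in S) != (t e \in S).
  by have : e \in cut s t S; [rewrite cutE set11 | rewrite inE].
have closedS : fingraph.closed R' (mem S).
  move=> x y /gadjP[g]; rewrite !inE => ge.
  have : g \notin cut s t S by rewrite cutE inE; case/andP: ge.
  by rewrite inE negbK => /eqP sg /joins_st[[<- <-]|[<- <-]].
have nconn : ~~ connect R' (s e) (t e).
  by apply: contra st_S => /(closed_connect closedS) ->.
have conn : connect R (s e) (t e).
  by apply/connect1/gadjP; exists e; rewrite ?inE // /joins !eqxx.
pose f := fingraph.root R.
have im : [set x | roots R x] \subset [set f x | x in [set x | roots R' x]].
  apply/subsetP=> x; rewrite inE => /eqP xr; apply/imsetP.
  exists (fingraph.root R' x); first by rewrite inE roots_root.
  rewrite /f -{1}xr; apply/eqP; rewrite root_connect //.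
  exact/sub/connect_root.
rewrite /n_comp_mem.
have cE Q : #|predI (roots Q) (mem predT)| = #|[set x | roots Q x]|.
  by apply: eq_card=> x; rewrite !inE andbT.
rewrite !cE; apply: leq_ltn_trans (subset_leq_card im) _.
rewrite ltn_neqAle leq_imset_card andbT; apply/negP=> /imset_injP inj.
case/negP: nconn; rewrite -(root_connect symR'); apply/eqP/inj; rewrite ?inE ?roots_root //.
apply/eqP; rewrite root_connect //.
have toroot x : connect R x (fingraph.root R' x) by apply/sub/connect_root.
rewrite -(same_connect symR (toroot (s e))).
by apply: connect_trans conn (toroot _).
Qed.

(** If the three edges at [v] have distinct, pairwise non-adjacent other ends, these form an induced
    claw with [v]. *)
Lemma claw_free_not_claw (V E : finType) (s t : E -> V) v : loopless s t ->
  cubic s t -> claw_free s t -> not_claw_center s t v.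
Proof.
move=> lst cst cf.
have /card_gt2P[e [f [g [[]]]]] : 2 < #|[set e | incident s t v e]| by rewrite [#|_|]cst.
rewrite !inE => ve vf vg [ef fg ge].
have only h : incident s t v h -> [|| h == e, h == f | h == g].
  move=> vh; apply: contraT; rewrite !negb_or => /and3P[he hf hg].
  have := cst v; rewrite /degree => d.
  have : #|[set h; e; f; g]| <= 3.
    rewrite -d; apply: subset_leq_card; apply/subsetP=> x.
    by rewrite !inE => /orP[/orP[/orP[]|]|]/eqP->.
  by rewrite -!setUA !cardsU1 cards1 !inE !negb_or he hf hg ef fg [e == g]eq_sym ge.
have [x jx] := incP ve; have [y jy] := incP vf; have [z jz] := incP vg.
have [xy|xy] := eqVneq x y; first by exists e, f, x, y; split=> //; left.
have [yz|yz] := eqVneq y z; first by exists f, g, y, z; split=> //; left.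
have [zx|zx] := eqVneq z x; first by exists g, e, z, x; split=> //; left.
have adj a b (h1 h2 : E) : h1 != h2 -> joins s t h1 v a -> joins s t h2 v b -> 
    mult s t a b != 0 -> not_claw_center s t v.
  move=> hh j1 j2; rewrite -lt0n => /card_gt0P[h]; rewrite inE => jh.
  by exists h1, h2, a, b; split=> //; right; exists h.
have [xy0|] := eqVneq (mult s t x y) 0; last exact: adj ef jx jy.
have [yz0|] := eqVneq (mult s t y z) 0; last exact: adj fg jy jz.
have [xz0|] := eqVneq (mult s t x z) 0; last by apply: adj jx jz; rewrite eq_sym.
have single a h : joins s t h v a -> (forall h', joins s t h' v a -> h' = h) -> mult s t v a = 1.
  move=> jh uh; apply/eqP/cards1P; exists h; apply/setP=> h'; rewrite !inE.
  by apply/idP/eqP=> [/uh|->].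
exfalso; apply: (cf v x y z); split.
  by rewrite /= !inE !negb_or (joins_neq lst jx) (joins_neq lst jy) (joins_neq lst jz) xy yz [x == z]eq_sym zx.
have fn := @joins_fun _ _ _ _ lst.
have edges h a : joins s t h v a -> h = e \/ h = f \/ h = g.
  by move/joins_incl/only=> /or3P[]/eqP; auto.
split; last split; last split => //.
- apply: (single x e jx) => h jh; have [//|[hE|hE]] := edges h x jh; subst h.
    by rewrite (fn _ _ _ _ jh jy) eqxx in xy.
  by rewrite (fn _ _ _ _ jh jz) eqxx in zx.
- apply: (single y f jy) => h jh; have [hE|[//|hE]] := edges h y jh; subst h.
    by rewrite (fn _ _ _ _ jh jx) eqxx in xy.
  by rewrite (fn _ _ _ _ jh jz) eqxx in yz.
- apply: (single z g jz) => h jh; have [hE|[hE|//]] := edges h z jh; subst h.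
    by rewrite (fn _ _ _ _ jh jx) eqxx in zx.
  by rewrite (fn _ _ _ _ jh jy) eqxx in yz.
Qed.

(** * The bound on [nu3] *)

(** Unit weights give [15 * uncolored c <= #|V|]; with [3 * #|V| = 2 * #|E|] at most 2/45 of the
    edges are uncoloured. *)
Lemma nu3_claw_free (V E : finType) (s t : E -> V) :
  loopless s t -> cubic s t -> bridgeless s t -> claw_free s t ->
  43 * #|E| <= 45 * nu3 s t.
Proof.
move=> lst cst bl cf.
have [c pc uc] := @weighted_bound #|V| V E s t (fun=> 1) (leqnn _) lst cst
  (fun S => bridgeless_cut S bl) (fun=> leqnn 1) (fun v => or_intror (claw_free_not_claw v lst cst cf)).
have VE : 3 * #|V| = 2 * #|E|.
  have := inner_cut lst cst setT; rewrite cardsT => ->.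
  rewrite (_ : inner s t setT = setT); last by apply/setP=> e; rewrite !inE.
  rewrite (_ : cut s t setT = set0); last by apply/setP=> e; rewrite !inE.
  by rewrite cardsT cards0 addn0.
have uV : 15 * uncolored c <= #|V| by rewrite -sum1_card.
have nu : #|E| - uncolored c <= nu3 s t.
  pose F := [set e | c e != None].
  have FE : #|F| = #|E| - uncolored c.
    have -> : F = ~: [set e | c e == None] by apply/setP=> e; rewrite !inE.
    by rewrite -(cardsC [set e | c e == None]) addKn.
  rewrite -FE; apply: (@leq_bigmax_cond _ (three_edge_colorable s t) (fun F : {set E} => #|F|)).
  have c3 : #|{: color}| = 3 by rewrite card_option card_bool.
  (* Edges outside [F] receive an arbitrary colour. *)
  apply/existsP; exists [ffun e => cast_ord c3 (enum_rank (odflt None (c e)))].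
  apply/forallP=> e; apply/forallP=> f; apply/implyP=> /and4P[]; rewrite !inE !ffunE.
  move=> ce cf' ef /existsP[v /andP[ve vf]]; apply/negP=> /eqP/cast_ord_inj/enum_rank_inj E1.
  have := pc v e f ve vf ef.
  by case: (c e) (c f) ce cf' E1 => [a|] // [b|] //= _ _ -> /(_ erefl).
have le : uncolored c <= #|E| by apply: max_card.
by lia.
Qed.

Import GRing.Theory Num.Theory.
Local Open Scope ring_scope.

Theorem theorem10 (V E : finType) (s t : E -> V) :
  loopless s t -> cubic s t -> bridgeless s t -> claw_free s t ->
  (43%:R / 45%:R) * (#|E|%:R : rat) <= (nu3 s t)%:R.
Proof.
move=> lst cst bl cf.
have := nu3_claw_free lst cst bl cf; rewrite -(ler_nat rat) !natrM => H.
by rewrite mulrAC ler_pdivrMr // [X in _ <= X]mulrC.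
Qed.
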